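(* Let $i,j,k,l$ be integers with $0<i<k\leq j<l$, and put $r=k-i$, $c=l-j$; assume $r<c<k$. Then $$\frac{P_jP_{l-i}}{P_iP_{j-i}P_{k-i}P_{l-k}}=\frac{P_{l-j}P_{k+j-i}}{P_{k-i}P_{l+i-j-k}P_kP_{j-i}}+\sum_{s=1}^{\min\{k-i,\,k-c\}}\frac{P_{k-c}P_{l-j}P_{k+j-i-s}}{P_sP_{k-c-s}P_{k-i-s}P_{l+i-j-k+s}P_kP_{j-i-s}}\,t^{2s(c-r+s)}$$ as an identity of polynomials in $t$.
   Context: For an integer $\alpha\geq 0$ put $h_\alpha=\sum_{m=0}^{\alpha}t^{2m}$; put $P_0=1$ and $P_\alpha=h_0h_1\cdots h_{\alpha-1}$ for $\alpha>0$. *)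

(* Defs.v *)
From HB Require Import structures.
From mathcomp Require Import all_boot all_order all_algebra.

Set Implicit Arguments.
Unset Strict Implicit.
Unset Printing Implicit Defensive.

Import GRing.Theory.
Local Open Scope ring_scope.

(* The indeterminate t is 'X, and coefficients are integers. *)
Definition h (a : nat) : {poly int} := \sum_(0 <= m < a.+1) 'X^(2 * m).

Definition P (a : nat) : {poly int} := \prod_(0 <= b < a) h b.

(* Fractions are formed in Z(t): {poly int} is not a field, and its %/ is a
   pseudo-division that is also defined when the divisor is not a factor. *)
Definition ratfun (p q : {poly int}) : {fraction {poly int}} :=
  FracField.tofrac p / FracField.tofrac q.

Definition is_polynomial (x : {fraction {poly int}}) : Prop :=
  exists p : {poly int}, x = FracField.tofrac p.

(* Main.v *)
Require Import Defs.
From HB Require Import structures.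
From mathcomp Require Import all_boot all_order all_algebra.
From mathcomp Require Import zify ring.

Set Implicit Arguments.
Unset Strict Implicit.
Unset Printing Implicit Defensive.

Import GRing.Theory.
Local Open Scope ring_scope.

(** With q = t^2, the polynomial h_(n-1) is the q-integer [n] and P_n is the
    q-factorial [n]!.  Every quotient of the theorem is then a product of
    Gaussian binomials, hence a polynomial, and with a = j - i and d = k - c
    the identity becomes a form of the q-Pfaff-Saalschuetz summation:
<<
  [a+c-r+d, a] [a+c, r]
     = sum_(s <= r) q^(s (c-r+s)) [d, s] [c, r-s] [d-s+c+a, a-s].
>>
    The term s = 0 is the isolated main term, and the terms with s > k - c
    vanish because [d, s] = 0 there.

    The summation follows from the q-Vandermonde identity used three times.
    Split the top of [(d-s) + (c+a), a-s] by q-Vandermonde, with v - s the part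
    chosen among the d - s ([qbinom_split]); since
    [d, s] [d-s, v-s] = [d, v] [v, s], the variable s now occurs only in
    [v, s] [c, r-s] and in the power of q, so that after exchanging the two
    sums q-Vandermonde sums it to [v+c, r].  Next,
    [c+a, a-v] [c+v, r] = [c+a, r] [c+a-r, a-v] takes r out of the sum over v,
    and a third q-Vandermonde gives [d + (c+a-r), a] ([qSaalschutz]). *)

(** * Gaussian binomials *)

Definition qnum (R : comNzRingType) (q : R) (n : nat) : R :=
  \sum_(0 <= m < n) q ^+ m.

Definition qfact (R : comNzRingType) (q : R) (n : nat) : R :=
  \prod_(0 <= b < n) qnum q b.+1.

(** Pascal's rule as the definition keeps the Gaussian binomial inside the ring,
    without division, and makes it vanish when k > n. *)
Fixpoint qbinom (R : comNzRingType) (q : R) (n k : nat) : R :=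
  match n, k with
  | _, 0 => 1
  | 0, _.+1 => 0
  | n'.+1, k'.+1 => q ^+ k * qbinom q n' k + qbinom q n' k'
  end.

Lemma qnumD (R : comNzRingType) (q : R) (m n : nat) :
  qnum q (m + n) = qnum q m + q ^+ m * qnum q n.
Proof.
rewrite /qnum (@big_cat_nat _ _ _ m) ?leq_addr //=; congr (_ + _).
rewrite -{1}(add0n m) big_addn addKn big_distrr /=.
by apply: eq_bigr => b _; rewrite addnC exprD.
Qed.

Lemma qfactS (R : comNzRingType) (q : R) (n : nat) :
  qfact q n.+1 = qfact q n * qnum q n.+1.
Proof. by rewrite /qfact big_nat_recr. Qed.

Lemma qfact0 (R : comNzRingType) (q : R) : qfact q 0 = 1.
Proof. by rewrite /qfact big_geq. Qed.

Lemma qbinom0 (R : comNzRingType) (q : R) (n : nat) : qbinom q n 0 = 1.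
Proof. by case: n. Qed.

Lemma qbinomS (R : comNzRingType) (q : R) (n k : nat) :
  qbinom q n.+1 k.+1 = q ^+ k.+1 * qbinom q n k.+1 + qbinom q n k.
Proof. by []. Qed.

Lemma qbinom_small (R : comNzRingType) (q : R) (n k : nat) :
  (n < k)%N -> qbinom q n k = 0.
Proof.
elim: n k => [|n IHn] [|k] //= lt_nk.
by rewrite -/(qbinom q n k.+1) !IHn ?mulr0 ?addr0 //; lia.
Qed.

Lemma qbinomn (R : comNzRingType) (q : R) (n : nat) : qbinom q n n = 1.
Proof.
by elim: n => // n IHn; rewrite qbinomS IHn qbinom_small // mulr0 add0r.
Qed.

Lemma qbinomD_fact (R : comNzRingType) (q : R) (m n : nat) :
  qbinom q (m + n) m * (qfact q m * qfact q n) = qfact q (m + n).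
Proof.
elim: m n => [|m IHm] n; first by rewrite qbinom0 qfact0 !mul1r.
elim: n => [|n IHn]; first by rewrite addn0 qbinomn qfact0 mul1r mulr1.
move: IHn (IHm n.+1); rewrite addSnnS !addSn qbinomS !qfactS => e1 e2.
(* [m+n+2] = [m+1] + q^(m+1) [n+1] matches the two terms of Pascal's rule. *)
rewrite -[(m + n.+1).+1]addSn qnumD mulrDr -{1}e2 -e1.
by ring.
Qed.

Lemma qbinom_fact (R : comNzRingType) (q : R) (n k : nat) :
  (k <= n)%N -> qbinom q n k * (qfact q k * qfact q (n - k)) = qfact q n.
Proof. by move=> le_kn; rewrite -{1 3}(subnKC le_kn) qbinomD_fact. Qed.

Lemma qbinom_trinomial (R : comNzRingType) (q : R) (n m k : nat) :
    (m + k <= n)%N ->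
  qbinom q n m * qbinom q (n - m) k *
    (qfact q m * qfact q k * qfact q (n - m - k)) = qfact q n.
Proof.
move=> le_mk.
rewrite -(@qbinom_fact _ q n m); last by lia.
by rewrite -(@qbinom_fact _ q (n - m) k); [ring | lia].
Qed.

(** Both sides are the q-multinomial [n]! / ([m]! [k]! [n-m-k]!). *)
Lemma qbinom_choose_swap (R : idomainType) (q : R) (n m k : nat) :
  (forall b, qfact q b != 0) -> (m + k <= n)%N ->
  qbinom q n m * qbinom q (n - m) k = qbinom q n k * qbinom q (n - k) m.
Proof.
move=> nz le_mk.
apply: (mulIf (mulf_neq0 (mulf_neq0 (nz m) (nz k)) (nz (n - m - k)%N))).
rewrite qbinom_trinomial // [qfact q m * _]mulrC.
have -> : (n - m - k = n - k - m)%N by lia.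
by rewrite qbinom_trinomial //; lia.
Qed.

(** Choosing an s-subset and then v - s further elements amounts to choosing a
    v-subset and then its s-subset; for v > n both sides vanish. *)
Lemma qbinom_subset (R : idomainType) (q : R) (n v s : nat) :
  (forall b, qfact q b != 0) -> (s <= v)%N -> (s <= n)%N ->
  qbinom q n s * qbinom q (n - s) (v - s) = qbinom q n v * qbinom q v s.
Proof.
move=> nz le_sv le_sn; case: (leqP v n) => [le_vn|lt_nv]; last first.
  have lt_sub : (n - s < v - s)%N by lia.
  by rewrite (qbinom_small q lt_nv) (qbinom_small q lt_sub) mulr0 mul0r.
apply: (mulIf (mulf_neq0 (mulf_neq0 (nz s) (nz (v - s)%N)) (nz (n - v)%N))).
have e : (n - v = n - s - (v - s))%N by lia.
rewrite {1}e qbinom_trinomial ?subnKC //.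
by rewrite -(@qbinom_fact _ q n v) // -(@qbinom_fact _ q v s) //; ring.
Qed.

(** * The q-Vandermonde identity *)

(** The exponent counts the pairs made of an unchosen element of the first block
    and a chosen element of the second.  The truncated subtraction m - v is
    harmless, because the term vanishes for v > m. *)
Lemma qVandermonde (R : comNzRingType) (q : R) (m n a : nat) :
  qbinom q (m + n) a =
  \sum_(0 <= v < a.+1)
    qbinom q m v * qbinom q n (a - v) * q ^+ ((m - v) * (a - v)).
Proof.
elim: m a => [|m IHm] a.
  rewrite big_nat_recl // big1 => [|v _]; last by rewrite /= !mul0r.
  by rewrite sub0n mul0n expr0 subn0 mulr1 mul1r addr0.
case: a => [|a]; first by rewrite big_nat1 !qbinom0 muln0 expr0 !mulr1.
rewrite addSn qbinomS !IHm big_distrr /=.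
rewrite big_nat_recl // [RHS]big_nat_recl // -addrA -big_split /=.
congr (_ + _).
  by rewrite !qbinom0 !subn0 !mul1r mulrCA -exprD -mulSn.
apply: eq_big_nat => v /andP[_ lt_va]; rewrite !subSS -/(qbinom q m v.+1) !mulrDl.
congr (_ + _).
case: (leqP v.+1 m) => [le_vm|lt_mv]; last first.
  by rewrite (qbinom_small q lt_mv) !(mul0r, mulr0).
rewrite mulrCA -exprD.
have -> : (a.+1 + (m - v.+1) * (a - v) = v.+1 + (m - v) * (a - v))%N by nia.
by rewrite exprD; ring.
Qed.

(** The same identity with the two blocks exchanged, for a second block with at
    least a elements, so that e + v counts its unchosen elements. *)
Lemma qVandermonde_addn (R : comNzRingType) (q : R) (m e a : nat) :
  qbinom q (m + (a + e)) a =
  \sum_(0 <= v < a.+1)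
    qbinom q m v * qbinom q (a + e) (a - v) * q ^+ (v * (e + v)).
Proof.
rewrite addnC qVandermonde big_nat_rev /=.
apply: eq_big_nat => v /andP[_ lt_va].
have -> : (0 + a.+1 - v.+1 = a - v)%N by lia.
rewrite subKn // [qbinom q (a + e) _ * _]mulrC.
by congr (_ * q ^+ _); nia.
Qed.

(** * The q-Pfaff-Saalschuetz summation *)

(** Replaces the product on the left, where s enters three arguments, by terms
    where [v, s] is the only Gaussian binomial with s in it. *)
Lemma qbinom_split (R : idomainType) (q : R) (a c d s : nat) :
    (forall b, qfact q b != 0) -> (s <= a)%N ->
  qbinom q d s * qbinom q (d - s + (c + a)) (a - s) =
  \sum_(0 <= v < a.+1) qbinom q d v * qbinom q v s * qbinom q (c + a) (a - v)
     * q ^+ ((v - s) * (c + v)).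
Proof.
move=> nz le_sa; case: (leqP s d) => [le_sd|lt_ds]; last first.
  rewrite (qbinom_small q lt_ds) mul0r big1 // => v _.
  case: (leqP s v) => [le_sv|lt_vs]; last first.
    by rewrite (qbinom_small q lt_vs) mulr0 !mul0r.
  by rewrite (@qbinom_small _ q d) ?mul0r //; lia.
rewrite (@big_cat_nat _ _ _ s) //=; last by lia.
rewrite big_nat big1 ?add0r => [|v /andP[_ lt_vs]]; last first.
  by rewrite (qbinom_small q lt_vs) mulr0 !mul0r.
(* q-Vandermonde runs over u = v - s. *)
have e : (c + a = (a - s) + (c + s))%N by lia.
rewrite {1}e qVandermonde_addn -e big_distrr /=.
rewrite -[in RHS](add0n s) big_addn subSn //.
apply: eq_big_nat => u /andP[_ lt_u].
have := @qbinom_subset _ q d (u + s) s nz (leq_addl _ _) le_sd; rewrite addnK => <-.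
have -> : (a - (u + s) = a - s - u)%N by lia.
have -> : (c + (u + s) = c + s + u)%N by lia.
by rewrite !mulrA.
Qed.

(** Exchanging the sums after [qbinom_split], the inner sum over s is
    q-Vandermonde for [v+c, r] and the outer one is q-Vandermonde again, once
    [qbinom_choose_swap] has moved r out of it. *)
Lemma qSaalschutz (R : idomainType) (q : R) (a c d r : nat) :
    (forall b, qfact q b != 0) -> (r <= a)%N -> (r <= c)%N ->
  qbinom q (d + (c + a - r)) a * qbinom q (c + a) r =
  \sum_(0 <= s < r.+1) qbinom q d s * qbinom q c (r - s)
     * qbinom q (d - s + (c + a)) (a - s) * q ^+ (s * (c - r + s)).
Proof.
move=> nz le_ra le_rc; symmetry.
under eq_big_nat => s /andP[_ lt_sr].
  rewrite [_ * _ * qbinom q (_ + _) _]mulrAC qbinom_split //; last by lia.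
  rewrite !mulr_suml.
  over.
rewrite exchange_big /=.
have e : (c + a - r = a + (c - r))%N by lia.
rewrite e qVandermonde_addn mulr_suml; apply: eq_big_nat => v /andP[_ lt_va].
transitivity (qbinom q d v * qbinom q (c + a) (a - v) * q ^+ (v * (c - r + v))
              * qbinom q (v + c) r).
  rewrite (qVandermonde q v c r) mulr_sumr; apply: eq_big_nat => s /andP[_ lt_sr].
  case: (leqP s v) => [le_sv|lt_vs]; last first.
    by rewrite (qbinom_small q lt_vs) !(mulr0, mul0r).
  (* The s-dependent part of the exponent becomes (v - s) (r - s), the one
     q-Vandermonde asks for. *)
  have E : q ^+ (s * (c - r + s)) * q ^+ ((v - s) * (c + v)) =
           q ^+ (v * (c - r + v)) * q ^+ ((v - s) * (r - s)).
    by rewrite -!exprD; congr (q ^+ _); nia.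
  transitivity (qbinom q d v * qbinom q v s * qbinom q (c + a) (a - v)
    * qbinom q c (r - s) * (q ^+ (s * (c - r + s)) * q ^+ ((v - s) * (c + v)))).
    by ring.
  by rewrite E; ring.
have := @qbinom_choose_swap _ q (c + a) (a - v) r nz.
have -> : (c + a - (a - v) = v + c)%N by lia.
rewrite e => /(_ ltac:(lia)) E.
transitivity (qbinom q d v * q ^+ (v * (c - r + v))
  * (qbinom q (c + a) (a - v) * qbinom q (v + c) r)); first by ring.
by rewrite E; ring.
Qed.

(** * Quotients of the P_n as Gaussian binomials *)

Lemma P_qfact (n : nat) : P n = qfact 'X^2 n.
Proof.
apply: eq_bigr => b _; apply: eq_bigr => m _.
by rewrite exprM.
Qed.

(** At t = 1 the q-integer [b+1] takes the nonzero value b + 1. *)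
Lemma qfactX2_neq0 (n : nat) : qfact ('X^2 : {poly int}) n != 0.
Proof.
rewrite /qfact prodf_seq_neq0; apply/allP => b _ /=.
apply/eqP => /(congr1 (fun p : {poly int} => p.[1])).
rewrite /qnum horner_sum horner0.
under eq_bigr do rewrite !hornerE !expr1n.
by rewrite sumr_const_nat subn0 => /eqP; rewrite Num.Theory.pnatr_eq0.
Qed.

Lemma ratfun_tofrac (x y z : {poly int}) :
  y != 0 -> x = z * y -> ratfun x y = FracField.tofrac z.
Proof.
move=> y_neq0 ->; rewrite /ratfun rmorphM mulfK //.
by rewrite tofrac_eq0.
Qed.

Lemma ratfun_mul2l (z x y : {poly int}) :
  z != 0 -> ratfun (z * x) (z * y) = ratfun x y.
Proof.
move=> z_neq0; rewrite /ratfun !rmorphM -mulf_div divff ?mul1r //.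
by rewrite tofrac_eq0.
Qed.

Theorem theorem4p2 (i j k l r c : nat)
  (hi : (0 < i)%N) (hik : (i < k)%N) (hkj : (k <= j)%N) (hjl : (j < l)%N)
  (hr : r = (k - i)%N) (hc : c = (l - j)%N)
  (hrc : (r < c)%N) (hck : (c < k)%N) :
  let lhs := ratfun (P j * P (l - i)%N)
    (P i * P (j - i)%N * P (k - i)%N * P (l - k)%N) in
  let main_term := ratfun (P (l - j)%N * P (k + j - i)%N)
    (P (k - i)%N * P (l + i - j - k)%N * P k * P (j - i)%N) in
  let coef (s : nat) := ratfun
    (P (k - c)%N * P (l - j)%N * P (k + j - i - s)%N)
    (P s * P (k - c - s)%N * P (k - i - s)%N * P (l + i - j - k + s)%N
     * P k * P (j - i - s)%N) in
  let N := minn (k - i) (k - c) in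
  lhs = main_term
      + \sum_(1 <= s < N.+1)
          coef s * FracField.tofrac 'X^(2 * s * (c - r + s))
  /\ [/\ is_polynomial lhs, is_polynomial main_term
       & forall s : nat, (1 <= s <= N)%N -> is_polynomial (coef s)].
Proof.
move=> lhs main_term coef N.
pose q : {poly int} := 'X^2.
have nz b : qfact q b != 0 by exact: qfactX2_neq0.
pose term s : {poly int} :=
  qbinom q (k - c) s * qbinom q c (r - s) * qbinom q (k + j - i - s) (j - i - s).
have lhsE : lhs =
    FracField.tofrac (qbinom q j (j - i) * qbinom q (l - i) (k - i)).
  apply: ratfun_tofrac; rewrite !P_qfact; first by rewrite !mulf_neq0.
  rewrite -(@qbinom_fact _ q j (j - i)); last by lia.
  rewrite -(@qbinom_fact _ q (l - i) (k - i)); last by lia.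
  have -> : (j - (j - i) = i)%N by lia.
  have -> : (l - i - (k - i) = l - k)%N by lia.
  by ring.
have coefE s : (s <= N)%N -> coef s = FracField.tofrac (term s).
  move=> le_sN; apply: ratfun_tofrac; rewrite !P_qfact; first by rewrite !mulf_neq0.
  rewrite -(@qbinom_fact _ q (k - c) s); last by lia.
  rewrite -(@qbinom_fact _ q (l - j) (k - i - s)); last by lia.
  rewrite -(@qbinom_fact _ q (k + j - i - s) (j - i - s)); last by lia.
  have -> : (k + j - i - s - (j - i - s) = k)%N by lia.
  have -> : (l - j - (k - i - s) = l + i - j - k + s)%N by lia.
  by rewrite /term hr hc; ring.
have mainE : main_term = FracField.tofrac (term 0).
  (* The main term is the term s = 0 with the common factor P (k - c)
     cancelled. *)
  rewrite -coefE // -[main_term](@ratfun_mul2l (P (k - c))); last first.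
    by rewrite P_qfact.
  rewrite /coef !subn0 addn0 [P 0]P_qfact qfact0.
  by congr ratfun; ring.
split; last split.
- rewrite lhsE mainE.
  under eq_big_nat => s /andP[_ lt_sN].
    rewrite coefE // -rmorphM.
    over.
  rewrite -rmorph_sum -rmorphD; congr FracField.tofrac.
  transitivity (qbinom q (k - c + (c + (j - i) - r)) (j - i)
                * qbinom q (c + (j - i)) r).
    by congr (qbinom _ _ _ * qbinom _ _ _); lia.
  rewrite qSaalschutz //; [|lia|lia].
  rewrite (@big_cat_nat _ _ _ N.+1) //=; last by rewrite ltnS hr geq_minl.
  (* The terms beyond N exist only when N = k - c, and there [k-c, s] = 0. *)
  rewrite [X in _ + X]big_nat [X in _ + X]big1 ?addr0; last first.
    move=> s /andP[lt_Ns lt_sr]; rewrite qbinom_small ?mul0r //.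
    by move: lt_Ns lt_sr; rewrite /N; lia.
  rewrite big_nat_recl // big_add1 /=; congr (_ + _).
    rewrite mul0n expr0 mulr1 /term.
    by congr (_ * qbinom _ _ _); lia.
  apply: eq_big_nat => s /andP[_ lt_sN]; rewrite /term -mulnA (exprM 'X 2).
  by congr (_ * qbinom _ _ _ * _); move: lt_sN; rewrite /N; lia.
- by rewrite lhsE; eexists.
- by rewrite mainE; eexists.
- by move=> s /andP[_ le_sN]; rewrite coefE //; eexists.
Qed.
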